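(* For every nonnegative integer $n$, $$a(n)+\sum_{\substack{k\ge 1\\ k+k^2\le n}} a(n-k-k^2)\equiv \Delta(n)\pmod 2,$$ where $\Delta(n)=1$ if $n=s(s+1)/2$ for some integer $s$, and $\Delta(n)=0$ otherwise.
   Context: Let $(q;q)_\infty=\prod_{n=1}^\infty(1-q^n)$ and $(q^2;q^2)_\infty=\prod_{n=1}^\infty(1-q^{2n})$. The number of cubic partitions $a(n)$ is defined for $n\ge 0$ by the generating function $\sum_{n=0}^\infty a(n)q^n=\frac{1}{(q;q)_\infty(q^2;q^2)_\infty}$; $a(m)$ for $m<0$ does not occur. *)

(* Defs.v *)
From mathcomp Require Import all_boot all_order all_algebra.
From mathcomp Require Import boolp.

Set Implicit Arguments.
Unset Strict Implicit.
Unset Printing Implicit Defensive.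

Import Order.TTheory GRing.Theory Num.Theory.
Local Open Scope ring_scope.

(* A formal power series over the integers is its sequence of coefficients. *)
Definition fps := nat -> int.

Definition fps_one : fps := fun n => (n == 0%N)%:R.

Definition fps_mul (u v : fps) : fps :=
  fun n => \sum_(i < n.+1) u i * v (n - i)%N.

(* First n coefficients v_0, ..., v_(n-1) of the inverse of u (for u_0 = 1),  *)
(* by the recurrence v_n = [n = 0] - \sum_(i < n) v_i u_(n-i).                *)
Fixpoint fps_inv_seq (u : fps) (n : nat) : seq int :=
  if n is m.+1 then
    let s := fps_inv_seq u m in
    rcons s (fps_one m - \sum_(i < m) s`_i * u (m - i)%N)
  else [::].

Definition fps_inv (u : fps) : fps := fun n => (fps_inv_seq u n.+1)`_n.

(* (q^d; q^d)_oo = \prod_(m >= 1) (1 - q^(d m)), for d > 0: the factors with  *)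
(* m > n do not affect the coefficient of q^n (see euler_prod_stable).        *)
Definition euler_prod (d : nat) : fps :=
  fun n => (\prod_(1 <= m < n.+1) (1 - 'X^(d * m)) : {poly int})`_n.

Definition cubic_partitions : fps :=
  fps_inv (fps_mul (euler_prod 1) (euler_prod 2)).

Definition Delta (n : nat) : int :=
  if `[< exists s : int, n%:Z = (s * (s + 1) %/ 2)%Z >] then 1 else 0.

Lemma euler_prod_stable (d n N : nat) : (0 < d)%N -> (n <= N)%N ->
  (\prod_(1 <= m < N.+1) (1 - 'X^(d * m)) : {poly int})`_n = euler_prod d n.
Proof.
move=> d0; elim: N => [|N IH]; first by rewrite leqn0 => /eqP->.
rewrite leq_eqVlt => /predU1P[->//|ltnN].
rewrite big_nat_recr //= mulrBr mulr1 coefB coefMXn IH //.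
by rewrite (leq_trans _ (leq_pmull _ d0)) // subr0.
Qed.

Lemma euler_prod0 (d : nat) : euler_prod d 0 = 1.
Proof. by rewrite /euler_prod big_geq // coef1. Qed.

Lemma size_fps_inv_seq (u : fps) (n : nat) : size (fps_inv_seq u n) = n.
Proof. by elim: n => //= n IH; rewrite size_rcons IH. Qed.

Lemma nth_fps_inv_seq (u : fps) (n i : nat) : (i < n)%N ->
  (fps_inv_seq u n)`_i = fps_inv u i.
Proof.
elim: n => // n IH; rewrite ltnS leq_eqVlt => /predU1P[->//|ltin].
by rewrite /= nth_rcons size_fps_inv_seq ltin IH.
Qed.

Lemma fps_inv_mul (u : fps) : u 0%N = 1 ->
  forall n, fps_mul (fps_inv u) u n = fps_one n.
Proof.
move=> u0 n; rewrite /fps_mul big_ord_recr /= subnn u0 mulr1.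
rewrite {2}/fps_inv /= nth_rcons size_fps_inv_seq ltnn eqxx.
under [X in _ + (_ - X)]eq_bigr => i _ do rewrite nth_fps_inv_seq //.
by rewrite addrC subrK.
Qed.

Lemma cubic_partitions_gf (n : nat) :
  fps_mul cubic_partitions (fps_mul (euler_prod 1) (euler_prod 2)) n =
  fps_one n.
Proof.
by apply: fps_inv_mul; rewrite /fps_mul big_ord1 subn0 !euler_prod0 mulr1.
Qed.

(* Main.v *)
(** Write E for (q;q)_oo and psi for the sum of q^(k(k+1)/2) over k >= 0.  Over
    F_2 squaring is q |-> q^2, so (q^2;q^2)_oo = E^2 and the left-hand side has
    generating function psi(q^2) / E^3 = psi^2 / E^3.  Gauss' identity
    psi = E \prod_(m >= 1) (1 + q^m)^2, that is psi = E^3 over F_2, turns this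
    into psi.  Gauss' identity comes from the coefficients of z^k in
    \prod_(1 <= m <= n) (1 + z q^m) \prod_(0 <= m <= n) (1 + z^-1 q^m),
    which are invariant under k |-> - k - 1: the half k >= 0 sums to
    \prod_(1 <= m <= n) (1 + q^m)^2 at z = 1, and each coefficient is
    q^(k(k+1)/2) times a q-binomial.  Power series are replaced by polynomials
    modulo X^(n+1). *)
Require Import Defs.
From mathcomp Require Import all_boot all_order all_algebra.
From mathcomp Require Import boolp ring.

Set Implicit Arguments.
Unset Strict Implicit.
Unset Printing Implicit Defensive.

Import Order.TTheory GRing.Theory Num.Theory.
Local Open Scope ring_scope.

(** * Triangular numbers *)

Definition triangular (k : nat) : nat := 'C(k.+1, 2).

Lemma triangularS (k : nat) : triangular k.+1 = (triangular k + k.+1)%N.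
Proof. by rewrite /triangular binS bin1. Qed.

Lemma triangular_ge (k : nat) : (k <= triangular k)%N.
Proof. by case: k => // k; rewrite triangularS leq_addl. Qed.

Lemma triangular_double (k : nat) : (2 * triangular k = k + k ^ 2)%N.
Proof.
rewrite /triangular bin2 /= mul2n halfK oddM /= andNb subn0.
by rewrite mulSn mulnn.
Qed.

Lemma triangular_inj : injective triangular.
Proof.
apply: incn_inj; apply: leq_mono; apply: homo_ltn; first exact: ltn_trans.
by move=> k; rewrite triangularS addnS ltnS leq_addr.
Qed.

(** * A finite form of Gauss' identity *)

Section FiniteGauss.

Variable R : comNzRingType.
Implicit Types n k j : nat.

Definition qpoch n : {poly R} := \prod_(1 <= m < n.+1) (1 - 'X^m).

Lemma qpoch0 : qpoch 0 = 1.
Proof. by rewrite /qpoch big_geq. Qed.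

Lemma qpochS n : qpoch n.+1 = qpoch n * (1 - 'X^(n.+1)).
Proof. by rewrite /qpoch big_nat_recr. Qed.

(* Coefficient of z^k, for k >= 0, in the finite triple product of the header.
   As the coefficients of z^0 and z^-1 agree, the junk value 0.-1 = 0 makes the
   recurrence below also correct for k = 0. *)
Fixpoint triple_coef n k : {poly R} :=
  if n is m.+1 then
    (1 + 'X^(n + n)) * triple_coef m k
    + 'X^n * (triple_coef m k.-1 + triple_coef m k.+1)
  else (k == 0%N)%:R.

Lemma triple_coef_gt n k : (n < k)%N -> triple_coef n k = 0.
Proof.
elim: n k => [|n IH] [|k] //= ltnk; rewrite !IH ?(mulr0, addr0) //.
  by apply: ltnW; apply: ltnW.
by apply: ltnW.
Qed.

(** Denominator-free form of: [triple_coef n k] is q^(k(k+1)/2) times the q-binomial of 2n+1 over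
    n-k, where n = k + j. In the induction on n, the three terms of the recurrence are put over one
    common denominator. *)
Lemma triple_coef_closed k j :
  triple_coef (k + j) k * (qpoch j * qpoch (k + j + k).+1)
  = 'X^(triangular k) * qpoch (k + j + (k + j)).+1.
Proof.
move En: (k + j)%N => n; elim: n k j En => [|n IH] k j En.
  have [-> ->] : k = 0%N /\ j = 0%N by case: k j En => [|k] [].
  by rewrite /triangular bin_small //= qpoch0 !mul1r.
set Q := qpoch (n + n).+1.
have h0 : triple_coef n k * (qpoch j * qpoch (n + k).+2)
    = 'X^(triangular k) * Q * ((1 - 'X^j) * (1 - 'X^((n + k).+2))).
  case: j En => [|j] En.
    by rewrite triple_coef_gt ?expr0 ?subrr ?(mul0r, mulr0) // -En addn0.
  rewrite -(IH k j); last by move: En; rewrite addnS => -[].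
  by rewrite !qpochS; ring.
(* ['C(k, 2)] equals [triangular k.-1] also at k = 0, where both vanish. *)
have hm : triple_coef n k.-1 * (qpoch j * qpoch (n + k).+2)
    = 'X^'C(k, 2) * Q * ((1 - 'X^((n + k).+1)) * (1 - 'X^((n + k).+2))).
  case: k En {h0} => [|k] En.
    rewrite add0n in En; rewrite En /= -/(triangular 0) -(IH 0%N n) //.
    by rewrite addn0 !qpochS; ring.
  rewrite -/(triangular k) -(IH k j); last by case: En.
  by rewrite addnS !qpochS /=; ring.
(* ['X^k * ('X - 'X^j)] stands for q^(k+1) (1 - q^(j-1)), in a form that makes sense at j = 0; for j
   <= 1 both sides vanish. *)
have hp : triple_coef n k.+1 * (qpoch j * qpoch (n + k).+2)
    = 'X^(triangular k) * Q * ('X^k * ('X - 'X^j) * (1 - 'X^j)).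
  case: j En {h0 hm} => [|[|j]] En.
  - rewrite triple_coef_gt ?expr0 ?subrr ?(mul0r, mulr0) //.
    by rewrite -En addn0 leqnSn.
  - rewrite triple_coef_gt ?expr1 ?subrr ?(mul0r, mulr0) //.
    by rewrite ltnS -ltnS -En addn1.
  have := IH k.+1 j; rewrite triangularS exprD => IHk.
  rewrite !qpochS; transitivity (triple_coef n k.+1 *
    (qpoch j * qpoch (n + k.+1).+1) * ((1 - 'X^(j.+1)) * (1 - 'X^(j.+2)))).
    by rewrite addnS !qpochS; ring.
  rewrite IHk; last by move: En; rewrite !addnS => -[].
  by rewrite -/Q !exprS; move: Q 'X 'X^j 'X^k 'X^(triangular k) => *; ring.
have -> : qpoch (n.+1 + n.+1).+1
    = Q * (1 - 'X^(n.+1) ^+ 2) * (1 - 'X * 'X^(n.+1) ^+ 2).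
  by rewrite addSn addnS 2!qpochS -!exprM -exprS muln2 -addnn addSn addnS.
have tk : 'X^(triangular k) = 'X^k * 'X^'C(k, 2) :> {poly R}.
  by rewrite -exprD /triangular binS bin1 addnC.
transitivity ((1 + 'X^(n.+1) ^+ 2)
    * (triple_coef n k * (qpoch j * qpoch (n + k).+2))
  + 'X^(n.+1) * (triple_coef n k.-1 * (qpoch j * qpoch (n + k).+2)
    + triple_coef n k.+1 * (qpoch j * qpoch (n + k).+2))).
  by rewrite /= -exprM muln2 -addnn addSn; ring.
have En' : 'X^((n + k).+1) = 'X^k * 'X^j * 'X^k :> {poly R}.
  by rewrite -!exprD En addSn.
rewrite h0 hm hp tk ['X^(_.+2)]exprS En' -En exprD.
move: Q 'X 'X^j 'X^k 'X^'C(k, 2) {h0 hm hp tk En'} => *; ring.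
Qed.

(* Summing the recurrence over k multiplies the sum by
   1 + q^(2n) + 2 q^n = (1 + q^n)^2. *)
Lemma sum_triple_coef n :
  \sum_(k < n.+1) triple_coef n k = \prod_(1 <= m < n.+1) (1 + 'X^m) ^+ 2.
Proof.
(* N stays free because the recurrence lowers n but not the range of k; the terms with k > n are
   zero. *)
have ext N : (n <= N)%N ->
  \sum_(k < N.+1) triple_coef n k = \prod_(1 <= m < n.+1) (1 + 'X^m) ^+ 2.
  elim: n N => [|n IH] N leN.
    rewrite big_geq // big_ord_recl /= big1 ?addr0 //.
  rewrite big_nat_recr //= -(IH N (ltnW leN)) big_split /= -!mulr_sumr.
  rewrite big_split /=.
  have -> : \sum_(k < N.+1) triple_coef n k.-1
    = triple_coef n 0 + \sum_(k < N.+1) triple_coef n k.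
    rewrite big_ord_recl /=; congr (_ + _).
    by rewrite [RHS]big_ord_recr /= triple_coef_gt // addr0.
  have -> : \sum_(k < N.+1) triple_coef n k.+1
    = \sum_(k < N.+1) triple_coef n k - triple_coef n 0.
    rewrite [in RHS]big_ord_recl addrC addKr big_ord_recr /=.
    by rewrite triple_coef_gt ?addr0 // ltnS ltnW.
  by rewrite exprD; ring.
exact: ext.
Qed.

End FiniteGauss.

(** * Gauss' identity modulo X^(n+1) *)

Section TruncatedGauss.

Variable F : fieldType.
Implicit Types p : {poly F}.

Lemma dvdXnP n p : reflect (forall i, (i < n)%N -> p`_i = 0) ('X^n %| p).
Proof.
apply: (iffP idP) => [/dvdpP[r ->] i ltin | p0]; first by rewrite coefMXn ltin.
rewrite -(poly_take_drop n p) dvdp_addr; first by rewrite dvdp_mulIr.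
suff -> : take_poly n p = 0 by rewrite dvdp0.
by apply/polyP=> i; rewrite coef_take_poly coef0; case: ifP => // /p0.
Qed.

Lemma dvd_qpochB m n : (n <= m)%N -> 'X^(n.+1) %| qpoch F m - qpoch F n.
Proof.
elim: m => [|m IH]; first by rewrite leqn0 => /eqP->; rewrite subrr dvdp0.
rewrite leq_eqVlt => /predU1P[->|lt_nm]; first by rewrite subrr dvdp0.
rewrite qpochS mulrBr mulr1 addrAC dvdp_subl ?IH //.
by apply: dvdp_mull; apply: dvdp_exp2l.
Qed.

(** The constant term of [qpoch F n] is 1, so this factor can be cancelled modulo powers of X. *)
Lemma coprime_qpoch m n : coprimep 'X^m (qpoch F n).
Proof.
apply: coprimep_expl; rewrite coprimep_sym coprimepX /root /qpoch horner_prod.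
rewrite big_seq big1 ?oner_eq0 // => i; rewrite mem_index_iota => /andP[i0 _].
by rewrite !hornerE expr0n -(prednK i0) subr0.
Qed.

(* Multiplied by the unit (q;q)_(n-k), the claim reduces to the stability of
   (q;q)_m modulo X^(n+1), the factor X^(k(k+1)/2) making up for n - k < n. *)
Lemma dvd_qpoch_triple_coef n k : (k <= n)%N ->
  'X^(n.+1) %| qpoch F n * triple_coef F n k - 'X^(triangular k).
Proof.
move=> le_kn; rewrite -(Gauss_dvdpr _ (coprime_qpoch n.+1 (n - k))).
have := triple_coef_closed F k (n - k); rewrite subnKC // => closed.
(* By the closed form the two leading products cancel, which leaves differences covered by
   [dvd_qpochB]. *)
have -> : qpoch F (n - k) * (qpoch F n * triple_coef F n k - 'X^(triangular k))
  = 'X^(triangular k) * (qpoch F (n + n).+1 - qpoch F (n - k))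
    - triple_coef F n k * qpoch F (n - k)
      * (qpoch F (n + k).+1 - qpoch F n).
  by rewrite [X in _ = X - _]mulrBr -closed; ring.
apply: dvdp_sub; last first.
  by apply: dvdp_mull; apply: dvd_qpochB; rewrite -addnS leq_addr.
apply: (@dvdp_trans _ ('X^(triangular k) * 'X^((n - k).+1))).
  rewrite -exprD dvdp_exp2l // addnS ltnS -{1}(subnKC le_kn).
  by rewrite leq_add2r triangular_ge.
apply: dvdp_mul => //; apply: dvd_qpochB.
by rewrite (leq_trans (leq_subr _ _)) // -addnS leq_addr.
Qed.

Lemma gauss_truncated n :
  'X^(n.+1) %| qpoch F n * \prod_(1 <= m < n.+1) (1 + 'X^m) ^+ 2
               - \sum_(k < n.+1) 'X^(triangular k).
Proof.
rewrite -sum_triple_coef mulr_sumr -sumrB.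
apply: (big_ind (fun p => 'X^(n.+1) %| p)); first exact: dvdp0.
  exact: dvdp_add.
by move=> k _; apply: dvd_qpoch_triple_coef; rewrite -ltnS.
Qed.

End TruncatedGauss.

(** * Delta and the generating function as truncated series *)

Lemma DeltaE n : Delta n = \sum_(k < n.+1) (n == triangular k)%:R.
Proof.
have tri k : ((k%:Z * (k%:Z + 1)) %/ 2)%Z = triangular k.
  rewrite -[k%:Z + 1]/((k + 1)%N%:Z) -PoszM mulnDr muln1 mulnn addnC.
  by rewrite -triangular_double PoszM mulKz.
rewrite /Delta; case: asboolP => [[s Es]|no].
  have [k Ek] : exists k, n = triangular k.
    (* A negative s = -(k+1) yields the same number as k, since s(s+1) = k(k+1). *)
    case: s Es => k Es; exists k; apply/eqP; rewrite -eqz_nat Es -tri //.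
    by rewrite NegzE; apply/eqP; congr (_ %/ _)%Z; rewrite -addn1 PoszD; ring.
  have ltk : (k < n.+1)%N by rewrite ltnS Ek triangular_ge.
  rewrite (bigD1 (Ordinal ltk)) //= -Ek eqxx big1 ?addr0 // => i nik.
  case: eqP => // Ei; case/eqP: nik; apply: val_inj => /=.
  by apply: triangular_inj; rewrite -Ei.
rewrite big1 // => k _; case: eqP => // En; case: no.
by exists k%:Z; rewrite tri -En.
Qed.

Lemma coef_euler_prod (R : comNzRingType) d N i : (0 < d)%N -> (i <= N)%N ->
  (\prod_(1 <= m < N.+1) (1 - 'X^(d * m)) : {poly R})`_i
  = (euler_prod d i)%:~R.
Proof.
move=> d0 le_iN; rewrite -(euler_prod_stable d0 le_iN).
have -> : \prod_(1 <= m < N.+1) (1 - 'X^(d * m)) = map_poly intr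
    (\prod_(1 <= m < N.+1) (1 - 'X^(d * m))) :> {poly R}.
  rewrite rmorph_prod; apply: eq_bigr => m _.
  by rewrite rmorphB /= rmorph1 map_polyXn.
by rewrite coef_map.
Qed.

Lemma cubic_partitions_truncated (F : fieldType) N :
  'X^(N.+1) %| (\poly_(i < N.+1) (cubic_partitions i)%:~R : {poly F})
    * (\prod_(1 <= m < N.+1) (1 - 'X^(1 * m))
       * \prod_(1 <= m < N.+1) (1 - 'X^(2 * m))) - 1.
Proof.
apply/dvdXnP => i; rewrite ltnS => le_iN.
rewrite coefB coef1 coefM.
have -> : (i == 0%N)%:R = (fps_one i)%:~R :> F by rewrite /fps_one; case: eqP.
rewrite -cubic_partitions_gf /fps_mul rmorph_sum /=.
rewrite -sumrB big1 // => -[j /=]; rewrite ltnS => le_ji _.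
rewrite coef_poly ltnS (leq_trans le_ji le_iN) rmorphM coefM rmorph_sum /=.
apply/eqP; rewrite subr_eq0; apply/eqP; congr (_ * _); apply: eq_bigr.
move=> -[l /=]; rewrite ltnS => le_l _; rewrite rmorphM /=.
have le_ijN : (i - j <= N)%N := leq_trans (leq_subr _ _) le_iN.
rewrite !coef_euler_prod //; first exact: leq_trans (leq_subr _ _) le_ijN.
exact: leq_trans le_l le_ijN.
Qed.

(** * Reduction modulo 2 *)

Lemma pchar2_polyF2 : 2%N \in [pchar {poly 'F_2}].
Proof. by rewrite pchar_poly pchar_Fp. Qed.

Lemma sqrD_F2 (p q : {poly 'F_2}) : (p + q) ^+ 2 = p ^+ 2 + q ^+ 2.
Proof. exact: (rmorphD (pFrobenius_aut pchar2_polyF2)). Qed.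

Lemma sqr_sum_F2 (I : Type) (r : seq I) (f : I -> {poly 'F_2}) :
  (\sum_(i <- r) f i) ^+ 2 = \sum_(i <- r) f i ^+ 2.
Proof. exact: (rmorph_sum (pFrobenius_aut pchar2_polyF2)). Qed.

(** In characteristic 2, 1 - q^(2m) = (1 + q^m)^2, which turns the product in Gauss' identity into
    (q^2;q^2)_oo. *)
Lemma gauss_F2 N :
  'X^(N.+1) %| (\prod_(1 <= m < N.+1) (1 - 'X^(1 * m)) : {poly 'F_2})
               * \prod_(1 <= m < N.+1) (1 - 'X^(2 * m))
               - \sum_(k < N.+1) 'X^(triangular k).
Proof.
suff -> : \prod_(1 <= m < N.+1) (1 - 'X^(2 * m))
    = \prod_(1 <= m < N.+1) (1 + 'X^m) ^+ 2 :> {poly 'F_2}.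
  under eq_bigr do rewrite mul1n.
  exact: gauss_truncated.
apply: eq_bigr => m _; rewrite sqrD_F2 expr1n -exprM mulnC.
by rewrite oppr_pchar2 // pchar2_polyF2.
Qed.

Lemma cubic_theta_F2 N :
  'X^(N.+1) %| (\poly_(i < N.+1) (cubic_partitions i)%:~R : {poly 'F_2})
               * (\sum_(k < N.+1) 'X^(2 * triangular k))
               - \sum_(k < N.+1) 'X^(triangular k).
Proof.
have := gauss_F2 N; have := cubic_partitions_truncated 'F_2 N.
set A := (\poly_(_ < _) _); set E := (X in _ * X - 1); set P := \sum_(_ < _) _.
move=> AE EP.
have -> : \sum_(k < N.+1) 'X^(2 * triangular k) = P ^+ 2.
  by rewrite sqr_sum_F2; apply: eq_bigr => k _; rewrite -exprM mulnC.
(* Here [E] is the truncated (q;q)_oo (q^2;q^2)_oo, inverse to [A] and congruent to [P], so A P^2 =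
   A E P = P modulo X^(N+1). *)
have -> : A * P ^+ 2 - P = (A * E - 1) * P - A * P * (E - P) by ring.
by apply: dvdp_sub; [apply: dvdp_mulr | apply: dvdp_mull].
Qed.

Theorem theorem4p1 (n : nat) :
  (cubic_partitions n
   + \sum_(1 <= k < n.+1 | (k + k ^ 2 <= n)%N) cubic_partitions (n - k - k ^ 2)%N
   = Delta n %[mod 2])%Z.
Proof.
apply/eqP; rewrite eqz_mod_dvd (dvdz_pcharf (pchar_Fp (isT : prime 2))).
rewrite rmorphB /= subr_eq0 DeltaE rmorph_sum rmorphD rmorph_sum /=.
have /dvdXnP/(_ n (ltnSn n)) := cubic_theta_F2 n.
rewrite coefB mulr_sumr !coef_sum => /subr0_eq theta_n.
have -> : \sum_(k < n.+1) (n == triangular k)%:R%:~R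
    = \sum_(k < n.+1) ('X^(triangular k) : {poly 'F_2})`_n.
  by apply: eq_bigr => k _; rewrite coefXn; case: eqP.
rewrite -theta_n; apply/eqP.
rewrite -(big_mkord xpredT (fun k => (_ * 'X^(2 * triangular k))`_n)).
(* The term k = 0 gives a(n); for k >= 1 the shift by k + k^2 gives a(n - k - k^2), or 0 when k +
   k^2 > n. *)
rewrite [RHS]big_ltn // [in LHS]big_mkcond; congr (_ + _).
  by rewrite mulr1 coef_poly ltnSn.
apply: eq_bigr => k _; rewrite coefMXn triangular_double ltnNge.
by case: ifP => //= _; rewrite coef_poly subnDA !ltnS -subnDA leq_subr.
Qed.
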